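(* Suppose there exists $C_1>0$ such that $\Lambda_{i,j}\leq C_1(i+j)\log(e+i\wedge j)$ for all $i,j\geq1$. If $M_1^{\mathrm{in}}+M_2^{\mathrm{in}}<\infty$, where $M_2^{\mathrm{in}}:=\sum_{i=1}^\infty i^2\omega_i^{\mathrm{in}}$, then every solution to the discrete OHS coagulation equations with kernel $\Lambda$ and initial data $(\omega_i^{\mathrm{in}})_{i\geq1}$ satisfies $M_1(t)=M_1^{\mathrm{in}}$ for all $t\geq0$.
   Context: $\mathbb{N}=\{1,2,3,\dots\}$ and $i\wedge j:=\min(i,j)$. Given a kernel $\Lambda_{i,j}=\Lambda_{j,i}\geq 0$ ($i,j\in\mathbb{N}$) and initial data $\omega_i^{\mathrm{in}}\geq 0$ ($i\in\mathbb{N}$), the discrete Oort--Hulst--Safronov (OHS) coagulation equations are $$\frac{d\omega_i}{dt}(t)=\omega_{i-1}(t)\sum_{j=1}^{i-1}j\Lambda_{i-1,j}\omega_j(t)-\omega_i(t)\sum_{j=1}^{i}j\Lambda_{i,j}\omega_j(t)-\sum_{j=i}^{\infty}\Lambda_{i,j}\omega_i(t)\omega_j(t),\quad i\in\mathbb{N},$$ with $\omega_i(0)=\omega_i^{\mathrm{in}}$ (the first term is absent, i.e. $0$, when $i=1$). A solution is a family $(\omega_i(t))_{i\in\mathbb{N},t\geq0}$ of nonnegative real numbers such that: for each $i$, $t\mapsto\omega_i(t)$ is locally absolutely continuous on $[0,\infty)$; for every $T>0$ and $i\in\mathbb{N}$, $\int_0^T\big[\omega_i(s)\sum_{j=1}^{i}j\Lambda_{i,j}\omega_j(s)+\omega_i(s)\sum_{j=i}^\infty\Lambda_{i,j}\omega_j(s)\big]ds<\infty$;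 the equation holds for Lebesgue-a.e. $t\geq0$ and every $i\in\mathbb{N}$; and $\omega_i(0)=\omega_i^{\mathrm{in}}$ for all $i\in\mathbb{N}$. $M_1(t):=\sum_{i=1}^\infty i\,\omega_i(t)$ is the total mass and $M_1^{\mathrm{in}}:=\sum_{i=1}^\infty i\,\omega_i^{\mathrm{in}}$. *)

(* Defs.v *)
From HB Require Import structures.
From mathcomp Require Import all_boot all_order all_algebra.
From mathcomp Require Import all_classical all_reals all_analysis.

Set Implicit Arguments.
Unset Strict Implicit.
Unset Printing Implicit Defensive.

Import Order.TTheory GRing.Theory Num.Theory.
Import numFieldNormedType.Exports.

Local Open Scope classical_set_scope.
Local Open Scope ring_scope.

(* Epsilon-delta absolute continuity on [a, b], tested on finite families of
   pairwise disjoint open subintervals. *)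
Definition abs_continuous (R : realType) (a b : R) (f : R -> R) : Prop :=
  forall eps : R, 0 < eps -> exists2 delta : R, 0 < delta &
    forall (n : nat) (x y : 'I_n -> R),
      (forall k, a <= x k /\ x k <= y k /\ y k <= b) ->
      trivIset setT (fun k => `]x k, y k[%classic) ->
      \sum_(k < n) (y k - x k) < delta ->
      \sum_(k < n) `|f (y k) - f (x k)| < eps.

(* Sizes range over {1, 2, ...}: families are indexed by nat, but entries with
   index 0 are never constrained and never contribute.  In particular the gain
   term vanishes for i = 1 because its sum is then empty.
   The value is an extended real, since the last series has nonnegative terms
   and may diverge. *)
Definition ohs_rhs (R : realType) (Lam : nat -> nat -> R) (w : nat -> R)
    (i : nat) : \bar R :=
  ((w i.-1 * \sum_(1 <= j < i) j%:R * Lam i.-1 j * w j)%R%:E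
   - (w i * \sum_(1 <= j < i.+1) j%:R * Lam i j * w j)%R%:E
   - \sum_(i <= j <oo) (Lam i j * w i * w j)%:E)%E.

(* omega i t is only meaningful for t >= 0.  The derivative in ohs_eqn is
   two-sided; its existence at t = 0 is not required, as {0} is negligible.
   Equality with the extended real ohs_rhs includes its finiteness. *)
Record ohs_solution (R : realType) (Lam : nat -> nat -> R) (win : nat -> R)
    (omega : nat -> R -> R) : Prop := OhsSolution {
  ohs_ge0 : forall (i : nat) (t : R), (1 <= i)%N -> 0 <= t -> 0 <= omega i t;
  ohs_lac : forall (i : nat) (T : R), (1 <= i)%N -> 0 < T ->
    abs_continuous 0 T (omega i);
  ohs_int : forall (i : nat) (T : R), (1 <= i)%N -> 0 < T ->
    (\int[@lebesgue_measure R]_(s in `[0%R, T])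
       ((omega i s * \sum_(1 <= j < i.+1) j%:R * Lam i j * omega j s)%R%:E
        + (omega i s)%:E * \sum_(i <= j <oo) (Lam i j * omega j s)%:E)
     < +oo)%E;
  ohs_eqn : {ae @lebesgue_measure R, forall t : R, 0 <= t ->
    forall i : nat, (1 <= i)%N ->
      derivable (omega i) t 1 /\
      (derive1 (omega i) t)%:E = ohs_rhs Lam (omega ^~ t) i};
  ohs_init : forall i : nat, (1 <= i)%N -> omega i 0 = win i }.

Definition moment (R : realType) (p : nat) (w : nat -> R) : \bar R :=
  (\sum_(1 <= i <oo) (i%:R ^+ p * w i)%:E)%E.

(* Main.v *)
Require Import Defs.
From mathcomp Require Import all_boot all_order all_algebra.
From mathcomp Require Import all_classical all_reals all_analysis.
From mathcomp Require Import measurable_realfun.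
From mathcomp Require Import ring lra zify.

(** Testing the equations against weights g_1, ..., g_N with g_{N+1} = 0 gives
    (weak_form), with W_ij = Lam i j * w_i * w_j,
      (sum_i g_i w_i)' = sum_(j <= i <= N) ((g_{i+1} - g_i) j - g_j) W_ij
                         - sum_(i <= N < j) g_i W_ij,
    and three choices of g give the result.

    - g_i = i.  No pair contributes positively, so the truncated mass cannot
      increase, hence M1(t) <= M1in.

    - g_i = i^2.  Discarding the losses and using Lam i j <= 2 C i ln(e + j) for
      j <= i, the truncated second moment Y satisfies
      Y' <= 6 C Y * sum_j j ln(e + j) w_j.  As ln is concave, the last sum is
      at most M1in ln(e + Y) + 1.  So Y' <= A (e + Y) ln(e + Y), an Osgood
      inequality: ln ln (e + Y) grows at most linearly, and Y stays bounded on
      [0, T] uniformly in the truncation.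

    - g_i = i (N + 1 - i), the sum of the truncated masses up to 1, ..., N.
      Every pair loses at most 3 i j W_ij, and the pairs that straddle N lose
      comparably little since j^2 w_j is summable; so the sum decreases at a
      rate bounded by a constant K independent of N.  It follows that
      (N + 1) M1(t) >= sum_i g_i win_i - K t; dividing by N + 1 and letting N
      grow, M1(t) >= M1in.  Averaging over the truncations replaces an
      estimate of the outgoing mass flux at one fixed N, which is not small for
      every N but only on average.

    Since the equations hold only almost everywhere, each integration in time
    goes through abs_continuous_ae_le: an absolutely continuous function whose
    derivative is almost everywhere at most K grows at rate at most K.  The
    Osgood inequality is brought into this form by composing with ln ln. *)

Import Order.TTheory GRing.Theory Num.Theory.
Import numFieldNormedType.Exports.
Local Open Scope ring_scope.

(** * Growth of absolutely continuous functions *)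

(** Cousin's covering lemma as an induction principle: a relation on endpoints
    that composes, and holds on all short intervals around each point, holds on
    the whole segment. *)
Lemma segment_gauge_ind {R : realType} (P : R -> R -> Prop) (a b : R) :
  a <= b -> (forall x, P x x) ->
  (forall x y z, P x y -> P y z -> P x z) ->
  (forall x, a <= x <= b -> exists2 d : R, 0 < d &
     forall u v, a <= u -> u <= x -> x <= v -> v <= b ->
       x - u < d -> v - x < d -> P u v) ->
  P a b.
Proof.
move=> ab Prefl Ptrans Ploc.
pose E := [set x | a <= x <= b /\ P a x]%classic.
have Ea : E a by split; rewrite ?lexx.
have Esup : has_sup E by split; [exists a | exists b => x [/andP[]]].
pose c := sup E.
have ac : a <= c by apply: ub_le_sup => //; case: Esup.
have cb : c <= b by apply: ge_sup; [exists a | move=> x [/andP[]]].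
have [d d0 Pc] := Ploc c (introT andP (conj ac cb)).
have [x [/andP[ax xb] Pax] cx] := sup_adherent d0 Esup; rewrite -/c in cx.
have xc : x <= c.
  by apply: ub_le_sup; [case: Esup | split=> //; rewrite ax xb].
have Pac : P a c by apply: (Ptrans _ x) => //; apply: Pc => //; lra.
have [<- //|cNb] := eqVneq c b.
have cb' : c < b by rewrite lt_neqAle cNb.
have [y [yb cy yd]] : exists y, [/\ y <= b, c < y & y - c < d].
  exists (Num.min b (c + d / 2)); split; first by rewrite ge_min lexx.
    by rewrite lt_min cb'; lra.
  by rewrite ltrBlDr gt_min; apply/orP; right; lra.
suff Ey : E y.
  by exfalso; have := ub_le_sup (proj2 Esup) Ey; rewrite -/c; lra.
split; first by rewrite yb andbT; lra.
by apply: (Ptrans _ c) => //; apply: Pc => //; lra.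
Qed.

Lemma derivable_le_slope {R : realType} (f : R -> R) (x K : R) :
  derivable f x 1 -> f^`()%classic x < K ->
  exists2 d : R, 0 < d & forall u v, u <= x -> x <= v -> x - u < d -> v - x < d ->
    f v - f u <= K * (v - u).
Proof.
move=> df fK.
have /cvgrPdist_lt/(_ (K - f^`()%classic x)) := df.
rewrite subr_gt0 => /(_ fK).
move=> -[d /= d0 Hd].
exists d => //.
have H h : h != 0 -> `|h| < d -> h^-1 * (f (h + x) - f x) < K.
  move=> h0 hd; have := Hd h; rewrite /= sub0r normrN => /(_ hd h0).
  rewrite -[(_ *: _)]/(_ * _) [h *: _]mulr1 -[lim _]/('D_1 f x) -derive1E.
  by move=> /ltr_distlCBl; lra.
have Hv v : x <= v -> v - x < d -> f v - f x <= K * (v - x).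
  rewrite le_eqVlt => /predU1P[<-|xv] vd; first by rewrite !subrr mulr0.
  have vx0 : 0 < v - x by rewrite subr_gt0.
  have := H (v - x); rewrite subrK gt_eqF// => /(_ isT).
  rewrite gtr0_norm// => /(_ vd).
  by rewrite mulrC ltr_pdivrMr// => /ltW.
have Hu u : u <= x -> x - u < d -> f x - f u <= K * (x - u).
  rewrite le_eqVlt => /predU1P[->|ux] ud; first by rewrite !subrr mulr0.
  have ux0 : u - x < 0 by rewrite subr_lt0.
  have := H (u - x); rewrite subrK lt_eqF// => /(_ isT).
  rewrite ltr0_norm// opprB => /(_ ud).
  by rewrite mulrC ltr_ndivrMr// => /ltW; lra.
move=> u v ux xv xu vx; have := Hu u ux xu; have := Hv v xv vx; lra.
Qed.

Lemma sum_length_lt {R : realType} (G : set R) (d : R) n (x y : 'I_n -> R) :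
  measurable G -> (lebesgue_measure G < d%:E)%E ->
  (forall k, x k <= y k) ->
  trivIset setT (fun k => `]x k, y k[%classic) ->
  (forall k, `]x k, y k[%classic `<=` G)%classic ->
  \sum_(k < n) (y k - x k) < d.
Proof.
move=> mG Gd xy triv sub; rewrite -lte_fin; apply: le_lt_trans Gd.
rewrite -sumEFin.
rewrite (eq_bigr (fun k => lebesgue_measure `]x k, y k[%classic)); last first.
  move=> k _; rewrite lebesgue_measure_itv /= lte_fin.
  case: ltP => // yx; have /eqP -> : x k == y k by rewrite eq_le xy yx.
  by rewrite subrr.
rewrite -(@measure_semi_additive_ord _ _ _ lebesgue_measure)//.
- apply: le_measure; rewrite ?inE//.
  + by apply: bigsetU_measurable => k _; exact: measurable_itv.
  + by apply: (big_ind (fun A => A `<=` G)%classic) => // A B AG BG z [/AG|/BG].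
- by apply: bigsetU_measurable => k _; exact: measurable_itv.
Qed.

(** On [a, b], [f] grows at rate at most [K] apart from its variation over a
    finite chain of intervals contained in [G].  This is the composable form of
    the estimate that a tagged partition with tags in or out of [G] yields. *)
Definition growth_bound {R : realType} (f : R -> R) (K : R) (G : set R)
    (a b : R) : Prop :=
  a <= b /\ exists s : seq (R * R),
    [/\ forall p, p \in s -> [/\ a <= p.1, p.1 <= p.2, p.2 <= b &
          (`]p.1, p.2[%classic `<=` G)%classic],
        pairwise (fun p q => p.2 <= q.1) s &
        f b - f a <= K * (b - a) + \sum_(p <- s) `|f p.2 - f p.1|].

Lemma growth_bound_trans {R : realType} (f : R -> R) K (G : set R) x y z :
  growth_bound f K G x y -> growth_bound f K G y z -> growth_bound f K G x z.
Proof.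
move=> [xy [s [sP sS sB]]] [yz [s' [sP' sS' sB']]]; split.
  exact: le_trans yz.
exists (s ++ s'); split.
- move=> p; rewrite mem_cat => /orP[/sP[? ? ? ?]|/sP'[? ? ? ?]]; split => //.
  + exact: le_trans yz.
  + exact: (le_trans xy).
- rewrite pairwise_cat sS sS' !andbT; apply/allrelP => p q.
  by move=> /sP[_ _ py _] /sP'[yq _ _ _]; exact: (le_trans py).
- by rewrite big_cat /=; lra.
Qed.

(** Cover the exceptional null set by an open [G] of small measure.  Points
    outside [G] have short intervals around them with slope at most [K + e'],
    and points of [G] have short intervals inside [G].  Cousin's lemma chains
    them, and absolute continuity makes the variation over the intervals inside
    [G] small.  As [K >= 0], the lengths of the latter may also be charged at
    slope [K], which keeps the bounds additive. *)
Lemma abs_continuous_ae_le {R : realType} (f : R -> R) (a b K : R) :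
  0 <= K -> a <= b -> abs_continuous a b f ->
  {ae @lebesgue_measure R, forall t, a <= t <= b ->
     derivable f t 1 /\ f^`()%classic t <= K} ->
  f b - f a <= K * (b - a).
Proof.
move=> K0 ab acf [B [mB B0 NB]].
apply/ler_addgt0Pr => e e0.
(* The error is [e'] from the slopes over length [b - a], plus [e'] from the
   variation inside [G]. *)
have e'0 : 0 < e / (b - a + 1) by rewrite divr_gt0//; lra.
set e' := e / _ in e'0.
have [d d0 acd] := acf e' e'0.
have [|G [oG BG muGB]] := lebesgue_regularity_outer mB _ d0.
  by rewrite [X in (X < _)%E]B0.
have mG : measurable G by exact: open_measurable.
have muG : (lebesgue_measure G < d%:E)%E.
  apply: le_lt_trans muGB.
  have -> : G = (G `\` B `|` B)%classic by rewrite setDKU.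
  rewrite (_ : (_ `|` B) `\` B = G `\` B)%classic; last first.
    by rewrite setDKU.
  rewrite (le_trans (measureU2 _ _ _))//=; [exact: measurableD|].
  by rewrite [X in (_ + X)%E]B0 adde0.
have [_ [s [sP sS sB]]] : growth_bound f (K + e') G a b.
  apply: segment_gauge_ind => //.
  - move=> x; split => //; exists [::]; split => //=.
    by rewrite big_nil !subrr mulr0 addr0.
  - by move=> x y z; exact: growth_bound_trans.
  - move=> x axb; have [Gx|NGx] := pselect (G x).
    + have /nbhs_ballP[r /= r0 rG] : nbhs x G by exact: open_nbhs_nbhs.
      exists r => // u v au ux xv vb xu vx; split; first exact: le_trans xv.
      exists [:: (u, v)]; split => //=.
      * move=> p; rewrite inE => /eqP -> /=; split => //.
          exact: le_trans xv.
        move=> z /=; rewrite in_itv /= => /andP[uz zv]; apply: rG.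
        by rewrite /ball /= ltr_distlC; apply/andP; split; lra.
      * rewrite big_seq1 /= -[leLHS]add0r lerD ?ler_norm// mulr_ge0//; lra.
    + have [dfx fxK] : derivable f x 1 /\ f^`()%classic x <= K.
        apply: contrapT => H; apply: NGx; apply: BG; apply: NB => /= /(_ axb).
        exact: H.
      have [|r r0 Hr] := @derivable_le_slope _ f x (K + e') dfx; first by lra.
      exists r => // u v au ux xv vb xu vx; split; first exact: le_trans xv.
      by exists [::]; split => //=; rewrite big_nil addr0; exact: Hr.
have ns (k : 'I_(size s)) : nth (a, a) s k \in s by exact: mem_nth.
have disj : trivIset setT (fun k : 'I_(size s) =>
    `](nth (a, a) s k).1, (nth (a, a) s k).2[%classic).
  apply/trivIsetP => i j _ _.
  wlog ij : i j / (i < j)%N.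
    move=> W; rewrite neq_lt => /orP[] ij.
      by apply: W => //; rewrite lt_eqF.
    by rewrite setIC; apply: W => //; rewrite lt_eqF.
  move=> _; apply/eqP/negPn/negP => /set0P[z [/=]].
  rewrite !in_itv /= => /andP[_ zi] /andP[jz _].
  have := pairwiseP (a, a) sS i j (ltn_ord _) (ltn_ord _) ij.
  by lra.
have : \sum_(k < size s) `|f (nth (a, a) s k).2 - f (nth (a, a) s k).1| < e'.
  apply: acd => //; first by move=> k; have [] := sP _ (ns k).
  by apply: (@sum_length_lt _ G d _ (fun k => (nth (a, a) s k).1)
    (fun k => (nth (a, a) s k).2)) => // k; have [] := sP _ (ns k).
rewrite -(big_mkord xpredT (fun k => `|f (nth (a, a) s k).2 - f (nth (a, a) s k).1|)).
rewrite -(big_nth (a, a) xpredT (fun p => `|f p.2 - f p.1|)) => sume.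
have : e' * (b - a + 1) = e by rewrite divfK// gt_eqF//; lra.
lra.
Qed.

(** * The weak form of the equations *)

Lemma sum_by_parts {R : comRingType} (g J : nat -> R) (n : nat) :
  J 0 = 0 ->
  \sum_(1 <= i < n.+1) g i * (J i.-1 - J i) =
  \sum_(1 <= i < n.+1) (g i.+1 - g i) * J i - g n.+1 * J n.
Proof.
move=> J0; elim: n => [|n IH]; first by rewrite !big_geq// J0; ring.
by rewrite !(big_nat_recr n.+1)//= IH; ring.
Qed.

Lemma exchange_triangle {R : nmodType} (F : nat -> nat -> R) (n : nat) :
  \sum_(1 <= i < n.+1) \sum_(i <= j < n.+1) F i j =
  \sum_(1 <= i < n.+1) \sum_(1 <= j < i.+1) F j i.
Proof.
elim: n => [|n IH]; first by rewrite !big_geq.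
rewrite [LHS](big_nat_recr n.+1)//= [RHS](big_nat_recr n.+1)//= big_nat1 -IH.
rewrite [X in _ = _ + X](big_nat_recr n.+1)//= addrA.
congr (_ + _); rewrite -big_split /=; apply: eq_big_nat => i /andP[_ iN].
by rewrite big_nat_recr//; exact: ltnW.
Qed.

(** The loss rate of size [i] due to partners larger than [N]; [fine] is harmless
    since the equation forces the series to converge. *)
Definition overflow {R : realType} (Lam : nat -> nat -> R) (x : nat -> R)
    (N i : nat) : R :=
  fine (\sum_(N.+1 <= j <oo) (Lam i j * x i * x j)%:E)%E.

(** The equation between extended reals excludes a divergent loss series, as
    [d] is real.  The last clause lets the overflow be estimated through its
    partial sums. *)
Lemma ohs_rhs_split {R : realType} (Lam : nat -> nat -> R) (x : nat -> R)
    (N i : nat) (d : R) :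
  (forall i j, (1 <= i)%N -> (1 <= j)%N -> 0 <= Lam i j) ->
  (forall i, (1 <= i)%N -> 0 <= x i) ->
  (1 <= i <= N)%N -> d%:E = ohs_rhs Lam x i ->
  [/\ d = x i.-1 * (\sum_(1 <= j < i) j%:R * Lam i.-1 j * x j)
      - x i * (\sum_(1 <= j < i.+1) j%:R * Lam i j * x j)
      - (\sum_(i <= j < N.+1) Lam i j * x i * x j + overflow Lam x N i),
      0 <= overflow Lam x N i &
      forall b, (forall n, \sum_(N.+1 <= j < n) Lam i j * x i * x j <= b) ->
        overflow Lam x N i <= b].
Proof.
move=> L0 x0 /andP[i1 iN].
have a0 k : (i <= k)%N -> (0 <= (Lam i k * x i * x k)%:E)%E.
  by move=> ik; rewrite lee_fin !mulr_ge0 ?L0 ?x0//; exact: leq_trans ik.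
rewrite /ohs_rhs (@nneseries_split _ _ i (N.+1 - i))// subnKC; last by lia.
have S0 : (0 <= \sum_(N.+1 <= j <oo) (Lam i j * x i * x j)%:E)%E.
  by apply: nneseries_ge0 => k Nk _; apply: a0; lia.
rewrite sumEFin /overflow; set S := (\sum_(N.+1 <= j <oo) _)%E in S0 *.
case SE : S S0 => [s| |]// s0.
rewrite -EFinD => -[->]; rewrite lee_fin in s0; split => // b Hb.
rewrite /= -lee_fin -SE; apply: lime_le.
  by apply: is_cvg_nneseries => k Nk _; apply: a0; lia.
by apply: nearW => n; rewrite sumEFin lee_fin.
Qed.

(** Summation by parts moves the difference onto the weights in the transport
    terms; relabelling the pairs in the loss terms by symmetry of [Lam] then
    makes all of them sums over [j <= i]. *)
Lemma weak_form {R : realType} (Lam : nat -> nat -> R) (x d g : nat -> R)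
    (N : nat) :
  (forall i j, (1 <= i)%N -> (1 <= j)%N -> Lam i j = Lam j i) ->
  (forall i j, (1 <= i)%N -> (1 <= j)%N -> 0 <= Lam i j) ->
  (forall i, (1 <= i)%N -> 0 <= x i) ->
  (forall i, (1 <= i <= N)%N -> (d i)%:E = ohs_rhs Lam x i) ->
  g N.+1 = 0 ->
  \sum_(1 <= i < N.+1) g i * d i =
  \sum_(1 <= i < N.+1) \sum_(1 <= j < i.+1)
     ((g i.+1 - g i) * j%:R - g j) * (Lam i j * x i * x j)
  - \sum_(1 <= i < N.+1) g i * overflow Lam x N i.
Proof.
move=> Lsym L0 x0 dE gN.
pose J i := x i * (\sum_(1 <= j < i.+1) j%:R * Lam i j * x j).
have J0 : J 0 = 0 by rewrite /J big_geq// mulr0.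
under eq_big_nat => i iN.
  have [-> _ _] := ohs_rhs_split _ _ N _ _ L0 x0 iN (dE i iN).
  rewrite -[X in x i * X]/(\sum_(1 <= j < i.+1) j%:R * Lam i j * x j).
  have -> : x i.-1 * (\sum_(1 <= j < i) j%:R * Lam i.-1 j * x j) = J i.-1.
    by case: i iN.
  rewrite -/(J i) mulrBr [g i * (_ + overflow _ _ _ _)]mulrDr mulr_sumr opprD addrA.
  over.
rewrite !big_split /= !sumrN sum_by_parts// gN mul0r subr0; congr (_ - _).
rewrite exchange_triangle -sumrB; apply: eq_big_nat => i /andP[i1 _].
rewrite /J !mulr_sumr -sumrB; apply: eq_big_nat => j /andP[j1 _].
by rewrite (Lsym j i)//; ring.
Qed.

(** * Estimates at a fixed time *)

Lemma ln_e_ge1 {R : realType} (y : R) : 0 <= y -> 1 <= ln (expR 1 + y).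
Proof.
move=> y0; rewrite -[leLHS](expRK 1) ler_ln ?posrE ?lerDl// ?expR_gt0//.
by rewrite ltr_pwDl// expR_gt0.
Qed.

(** A concave function lies below its tangent at [y]. *)
Lemma ln_tangent {R : realType} (y z : R) : 0 <= y -> 0 <= z ->
  ln (expR 1 + z) <= ln (expR 1 + y) + (z - y) / (expR 1 + y).
Proof.
move=> y0 z0; have e0 := expR_gt0 (1 : R).
have ey0 : 0 < expR 1 + y by rewrite ltr_pwDl.
have ez0 : 0 < expR 1 + z by rewrite ltr_pwDl.
rewrite -lerBlDl -ln_div ?posrE//.
have -> : (expR 1 + z) / (expR 1 + y) = 1 + (z - y) / (expR 1 + y).
  by field; rewrite gt_eqF.
by apply: le_ln1Dx; rewrite ltr_pdivlMr//; lra.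
Qed.

Definition log_linear_kernel {R : realType} (Lam : nat -> nat -> R) (C : R) :=
  forall i j, (1 <= i)%N -> (1 <= j)%N ->
    Lam i j <= C * (i + j)%:R * ln (expR 1 + (minn i j)%:R).

Lemma log_linear_kernel_le {R : realType} (Lam : nat -> nat -> R) (C : R) i j :
  0 <= C -> log_linear_kernel Lam C -> (1 <= j)%N -> (j <= i)%N ->
  Lam i j <= 2 * C * i%:R * ln (expR 1 + j%:R).
Proof.
move=> C0 LC j1 ji; have := LC i j (leq_trans j1 ji) j1.
rewrite (minn_idPr ji) => /le_trans; apply.
apply: ler_wpM2r; first by rewrite (le_trans ler01)// ln_e_ge1.
rewrite [2 * C]mulrC -mulrA ler_wpM2l// -natrM ler_nat; lia.
Qed.

Definition log_moment {R : realType} (x : nat -> R) (N : nat) : R :=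
  \sum_(1 <= j < N.+1) j%:R * ln (expR 1 + j%:R) * x j.

Definition trunc_moment {R : realType} (p : nat) (x : nat -> R) (N : nat) : R :=
  \sum_(1 <= j < N.+1) j%:R ^+ p * x j.

(** Both the second moment and the averaged mass produce the pair weight
    [3 i j]; the kernel bound splits it into [i^2] and [j ln(e + j)]. *)
Lemma pair_sum_le {R : realType} (Lam : nat -> nat -> R) (C : R) (x : nat -> R)
    (N : nat) :
  0 <= C -> log_linear_kernel Lam C ->
  (forall i, (1 <= i)%N -> 0 <= x i) ->
  \sum_(1 <= i < N.+1) \sum_(1 <= j < i.+1)
     3 * i%:R * j%:R * (Lam i j * x i * x j) <=
  6 * C * trunc_moment 2 x N * log_moment x N.
Proof.
move=> C0 LC x0; rewrite /trunc_moment mulr_sumr mulr_suml.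
apply: ler_sum_nat => i /andP[i1 iN].
apply: (@le_trans _ _ (6 * C * (i%:R ^+ 2 * x i) * log_moment x i)); last first.
  apply: ler_wpM2l; first by rewrite !mulr_ge0// x0.
  rewrite /log_moment (@big_cat_nat _ _ _ i.+1 1 N.+1)//=.
  rewrite lerDl big_nat_cond sumr_ge0// => j /andP[/andP[ij _] _].
  rewrite mulr_ge0 ?x0//; last by lia.
  by rewrite mulr_ge0// (le_trans ler01)// ln_e_ge1.
rewrite mulr_sumr; apply: ler_sum_nat => j /andP[j1 ji].
have -> : 3 * i%:R * j%:R * (Lam i j * x i * x j) =
  (3 * i%:R * j%:R * x i * x j) * Lam i j by ring.
have -> : 6 * C * (i%:R ^+ 2 * x i) * (j%:R * ln (expR 1 + j%:R) * x j) =
  (3 * i%:R * j%:R * x i * x j) * (2 * C * i%:R * ln (expR 1 + j%:R)) by ring.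
by apply: ler_wpM2l; [rewrite !mulr_ge0// x0 | exact: log_linear_kernel_le].
Qed.

(** What the equations say at one time: [x] is the vector of concentrations and
    [d] the vector of their time derivatives. *)
Definition ohs_state {R : realType} (Lam : nat -> nat -> R) (x d : nat -> R) :=
  (forall i, (1 <= i)%N -> 0 <= x i) /\
  (forall i, (1 <= i)%N -> (d i)%:E = ohs_rhs Lam x i).

Lemma overflow_weight_ge0 {R : realType} (Lam : nat -> nat -> R)
    (x d g : nat -> R) (N : nat) :
  (forall i j, (1 <= i)%N -> (1 <= j)%N -> 0 <= Lam i j) ->
  ohs_state Lam x d -> (forall i, (1 <= i <= N)%N -> 0 <= g i) ->
  0 <= \sum_(1 <= i < N.+1) g i * overflow Lam x N i.
Proof.
move=> L0 [x0 dE] g0; rewrite big_nat_cond sumr_ge0// => i /andP[iN _].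
rewrite mulr_ge0 ?g0//; have /andP[i1 _] := iN.
by have [] := ohs_rhs_split _ _ N _ _ L0 x0 iN (dE i i1).
Qed.

(** With the weights [i], the coefficient [(g_{i+1} - g_i) j - g_j] vanishes
    for [i < N] and is negative at the cut-off [i = N]. *)
Lemma mass_rate_le0 {R : realType} (Lam : nat -> nat -> R) (x d : nat -> R)
    (N : nat) :
  (forall i j, (1 <= i)%N -> (1 <= j)%N -> Lam i j = Lam j i) ->
  (forall i j, (1 <= i)%N -> (1 <= j)%N -> 0 <= Lam i j) ->
  ohs_state Lam x d ->
  \sum_(1 <= i < N.+1) i%:R * d i <= 0.
Proof.
move=> Lsym L0 st; have [x0 dE] := st.
pose g i : R := if (i <= N)%N then i%:R else 0.
rewrite (eq_big_nat _ _ (F2 := fun i => g i * d i)); last first.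
  by move=> i /andP[_ iN]; rewrite /g -ltnS iN.
rewrite (weak_form Lam x) ?/g ?ltnn// -/g; last by move=> i /andP[+ _]; exact: dE.
have ov : 0 <= \sum_(1 <= i < N.+1) g i * overflow Lam x N i.
  by apply: (overflow_weight_ge0 Lam x d) => // i _; rewrite /g; case: ifP.
rewrite subr_le0 (le_trans _ ov)// big_nat_cond sumr_le0// => i /andP[/andP[i1 iN] _].
rewrite big_nat_cond sumr_le0// => j /andP[/andP[j1 ji] _].
rewrite mulr_le0_ge0//; last by rewrite !mulr_ge0 ?L0 ?x0.
rewrite ltnS in iN; rewrite /g iN (_ : (j <= N)%N); last by lia.
case: ifP => _; first by rewrite -natrB// subSnn; lra.
have : 0 <= i%:R * j%:R :> R by rewrite mulr_ge0.
have : 0 <= j%:R :> R by [].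
lra.
Qed.

(** With the weights [i^2], the coefficient is [(2 i + 1) j - j^2 <= 3 i j],
    and the cut-off only produces losses. *)
Lemma second_moment_rate_le {R : realType} (Lam : nat -> nat -> R) (C : R)
    (x d : nat -> R) (N : nat) :
  (forall i j, (1 <= i)%N -> (1 <= j)%N -> Lam i j = Lam j i) ->
  (forall i j, (1 <= i)%N -> (1 <= j)%N -> 0 <= Lam i j) ->
  0 <= C -> log_linear_kernel Lam C -> ohs_state Lam x d ->
  \sum_(1 <= i < N.+1) i%:R ^+ 2 * d i <=
  6 * C * trunc_moment 2 x N * log_moment x N.
Proof.
move=> Lsym L0 C0 LC st; have [x0 dE] := st.
apply: le_trans (pair_sum_le Lam C x N C0 LC x0).
pose g i : R := if (i <= N)%N then i%:R ^+ 2 else 0.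
rewrite (eq_big_nat _ _ (F2 := fun i => g i * d i)); last first.
  by move=> i /andP[_ iN]; rewrite /g -ltnS iN.
rewrite (weak_form Lam x) ?/g ?ltnn// -/g; last by move=> i /andP[+ _]; exact: dE.
have ov : 0 <= \sum_(1 <= i < N.+1) g i * overflow Lam x N i.
  by apply: (overflow_weight_ge0 Lam x d) => // i _; rewrite /g; case: ifP.
rewrite lerBlDr (le_trans _ (ler_wpDr ov (lexx _)))//.
apply: ler_sum_nat => i /andP[i1 iN]; apply: ler_sum_nat => j /andP[j1 ji].
apply: ler_wpM2r; first by rewrite !mulr_ge0 ?L0 ?x0.
rewrite ltnS in iN; rewrite /g iN (_ : (j <= N)%N); last by lia.
have i1R : 1 <= i%:R :> R by rewrite ler1n.
have j1R : 1 <= j%:R :> R by rewrite ler1n.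
case: ifP => _; last by nra.
by rewrite -natr1; nra.
Qed.

(** Partners larger than [N] satisfy [(N + 1) j <= j^2], so the second moment
    controls the overflow with a gain of a factor [N + 1]. *)
Lemma overflow_le {R : realType} (Lam : nat -> nat -> R) (C B : R)
    (x d : nat -> R) (N i : nat) :
  (forall i j, (1 <= i)%N -> (1 <= j)%N -> Lam i j = Lam j i) ->
  (forall i j, (1 <= i)%N -> (1 <= j)%N -> 0 <= Lam i j) ->
  0 <= C -> log_linear_kernel Lam C -> ohs_state Lam x d ->
  (forall n, trunc_moment 2 x n <= B) -> (1 <= i <= N)%N ->
  N.+1%:R * overflow Lam x N i <= 2 * C * B * ln (expR 1 + i%:R) * x i.
Proof.
move=> Lsym L0 C0 LC [x0 dE] MB iN; have /andP[i1 iN'] := iN.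
have lg0 : 0 <= ln (expR 1 + i%:R :> R) by rewrite (le_trans ler01)// ln_e_ge1.
have B0 : 0 <= B by have := MB 0; rewrite /trunc_moment big_geq.
rewrite mulrC -ler_pdivlMr//.
have [_ _] := ohs_rhs_split _ _ N _ _ L0 x0 iN (dE i i1); apply => n.
rewrite ler_pdivlMr// mulrC.
have [nN|Nn] := leqP n N.+1.
  by rewrite big_geq// mulr0 !mulr_ge0// x0.
rewrite mulr_sumr.
apply: (@le_trans _ _ (\sum_(N.+1 <= j < n)
    2 * C * ln (expR 1 + i%:R) * x i * (j%:R ^+ 2 * x j))).
  apply: ler_sum_nat => j /andP[Nj jn].
  have j1 : (1 <= j)%N by lia.
  rewrite Lsym//; have -> : N.+1%:R * (Lam j i * x i * x j) =
     x i * x j * (N.+1%:R * Lam j i) by ring.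
  have -> : 2 * C * ln (expR 1 + i%:R) * x i * (j%:R ^+ 2 * x j) =
     x i * x j * (j%:R * (2 * C * j%:R * ln (expR 1 + i%:R))) by ring.
  rewrite ler_wpM2l ?mulr_ge0 ?x0// ler_pM ?L0 ?ler_nat//.
  by apply: log_linear_kernel_le => //; lia.
rewrite -mulr_sumr.
have -> : 2 * C * B * ln (expR 1 + i%:R) * x i =
  2 * C * ln (expR 1 + i%:R) * x i * B by ring.
apply: ler_wpM2l; first by rewrite !mulr_ge0// x0.
apply: le_trans (MB n); rewrite /trunc_moment.
rewrite (@big_cat_nat _ _ _ N.+1 1 n.+1)//=; last by lia.
rewrite [X in _ + X]big_nat_recr//=; last by lia.
have h1 : 0 <= \sum_(1 <= j < N.+1) j%:R ^+ 2 * x j.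
  by rewrite big_nat_cond sumr_ge0// => j /andP[/andP[j1 _] _]; rewrite mulr_ge0 ?x0.
have h2 : 0 <= n%:R ^+ 2 * x n by rewrite mulr_ge0// x0//; lia.
lra.
Qed.

(** With the weights [i (N + 1 - i)], the coefficient is
    [- (2 i + 1 - j) j >= - 3 i j]: the factor [N] cancels.  In the overflow
    terms it is absorbed by the gain in [overflow_le]. *)
Lemma cesaro_mass_rate_ge {R : realType} (Lam : nat -> nat -> R) (C B : R)
    (x d : nat -> R) (N : nat) :
  (forall i j, (1 <= i)%N -> (1 <= j)%N -> Lam i j = Lam j i) ->
  (forall i j, (1 <= i)%N -> (1 <= j)%N -> 0 <= Lam i j) ->
  0 <= C -> log_linear_kernel Lam C -> ohs_state Lam x d ->
  (forall n, trunc_moment 2 x n <= B) ->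
  - (8 * C * B * log_moment x N) <=
  \sum_(1 <= i < N.+1) (i%:R * (N.+1%:R - i%:R)) * d i.
Proof.
move=> Lsym L0 C0 LC st MB; have [x0 dE] := st.
have lm0 : 0 <= log_moment x N.
  rewrite /log_moment big_nat_cond sumr_ge0// => i /andP[/andP[i1 _] _].
  by rewrite !mulr_ge0 ?x0// (le_trans ler01)// ln_e_ge1.
pose g i : R := i%:R * (N.+1%:R - i%:R).
rewrite -/(g _) (weak_form Lam x) //; first last.
- by rewrite /g subrr mulr0.
- by move=> i /andP[+ _]; exact: dE.
have main : - (6 * C * B * log_moment x N) <= \sum_(1 <= i < N.+1)
    \sum_(1 <= j < i.+1) ((g i.+1 - g i) * j%:R - g j) * (Lam i j * x i * x j).
  rewrite lerNl -sumrN.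
  apply: (@le_trans _ _ (6 * C * trunc_moment 2 x N * log_moment x N)); last first.
    by rewrite ler_wpM2r// ler_wpM2l// mulr_ge0.
  apply: le_trans (pair_sum_le Lam C x N C0 LC x0).
  apply: ler_sum_nat => i /andP[i1 iN]; rewrite -sumrN.
  apply: ler_sum_nat => j /andP[j1 ji].
  rewrite -mulNr ler_wpM2r//; first by rewrite !mulr_ge0 ?L0 ?x0.
  rewrite /g -[in i.+1%:R]natr1.
  have i1R : 1 <= i%:R :> R by rewrite ler1n.
  have j1R : 1 <= j%:R :> R by rewrite ler1n.
  by nra.
have ov : \sum_(1 <= i < N.+1) g i * overflow Lam x N i <=
    2 * C * B * log_moment x N.
  rewrite /log_moment mulr_sumr; apply: ler_sum_nat => i iN.
  have i1 : (1 <= i)%N by case/andP: iN.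
  have [_ o0 _] := ohs_rhs_split _ _ N _ _ L0 x0 iN (dE i i1).
  have := overflow_le _ _ _ _ _ N i Lsym L0 C0 LC st MB iN.
  have -> : 2 * C * B * (i%:R * ln (expR 1 + i%:R) * x i) =
     i%:R * (2 * C * B * ln (expR 1 + i%:R) * x i) by ring.
  move=> H; rewrite /g -[leLHS]mulrA; apply: ler_wpM2l => //.
  apply: le_trans H; apply: ler_wpM2r => //.
  by rewrite lerBlDr lerDl.
lra.
Qed.

(** Jensen's inequality for [ln], with the tangent point [y] left free so that
    no normalisation by the mass is required. *)
Lemma log_moment_le {R : realType} (x : nat -> R) (N : nat) (y : R) :
  0 <= y -> (forall i, (1 <= i)%N -> 0 <= x i) ->
  log_moment x N <= trunc_moment 1 x N * ln (expR 1 + y)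
                    + trunc_moment 2 x N / (expR 1 + y).
Proof.
move=> y0 x0; rewrite /trunc_moment !mulr_suml -big_split /=.
apply: ler_sum_nat => i /andP[i1 _].
have ey0 : 0 < expR 1 + y by rewrite ltr_pwDl// expR_gt0.
have -> : i%:R ^+ 1 * x i * ln (expR 1 + y) + i%:R ^+ 2 * x i / (expR 1 + y) =
  i%:R * x i * (ln (expR 1 + y) + i%:R / (expR 1 + y)) by ring.
rewrite [leLHS]mulrAC ler_wpM2l ?mulr_ge0 ?x0//.
apply: (le_trans (ln_tangent y i%:R y0 _)) => //.
rewrite lerD2l ler_wpM2r ?invr_ge0 ?(ltW ey0)//.
by rewrite lerBlDr lerDl.
Qed.

(** * Absolute continuity and a nonlinear Gronwall inequality *)

Lemma abs_continuous_dominated {R : realType} (a b L : R) (f h : R -> R) :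
  0 < L ->
  (forall x y, a <= x -> x <= y -> y <= b -> `|h y - h x| <= L * `|f y - f x|) ->
  abs_continuous a b f -> abs_continuous a b h.
Proof.
move=> L0 hf acf e e0; have [d d0 Hd] := acf (e / L) (divr_gt0 e0 L0).
exists d => // n x y xy disj lt_d.
apply: (@le_lt_trans _ _ (L * \sum_(k < n) `|f (y k) - f (x k)|)).
  by rewrite mulr_sumr; apply: ler_sum => k _; have [? [? ?]] := xy k; exact: hf.
by rewrite mulrC -ltr_pdivlMr//; exact: Hd.
Qed.

Lemma abs_continuousD {R : realType} (a b : R) (f h : R -> R) :
  abs_continuous a b f -> abs_continuous a b h ->
  abs_continuous a b (fun t => f t + h t).
Proof.
move=> acf ach e e0; have e20 : 0 < e / 2 by rewrite divr_gt0.
have [d d0 Hd] := acf _ e20; have [d' d'0 Hd'] := ach _ e20.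
exists (Num.min d d'); first by rewrite lt_min d0.
move=> n x y xy disj; rewrite lt_min => /andP[lt_d lt_d'].
have H := Hd n x y xy disj lt_d; have H' := Hd' n x y xy disj lt_d'.
apply: (@lt_le_trans _ _ (e / 2 + e / 2)); last by lra.
apply: le_lt_trans (ltrD H H'); rewrite -big_split /=; apply: ler_sum => k _.
by rewrite opprD addrACA ler_normD.
Qed.

Lemma abs_continuous_lincomb {R : realType} (a b : R) (w : nat -> R -> R)
    (c : nat -> R) (N : nat) :
  (forall i, (1 <= i)%N -> abs_continuous a b (w i)) ->
  abs_continuous a b (fun t => \sum_(1 <= i < N.+1) c i * w i t).
Proof.
move=> acw; elim: N => [|N IH].
  move=> e e0; exists 1 => // n x y _ _ _; rewrite big1// => k _.
  by rewrite !big_geq// subrr normr0.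
rewrite (_ : (fun t => _) = fun t => \sum_(1 <= i < N.+1) c i * w i t
    + c N.+1 * w N.+1 t); last by apply/funext => t; rewrite big_nat_recr.
apply: abs_continuousD => //.
apply: (@abs_continuous_dominated _ a b (`|c N.+1| + 1) (w N.+1)); last exact: acw.
- by rewrite ltr_wpDl.
- by move=> x y _ _ _; rewrite -mulrBr normrM ler_wpM2r// lerDl.
Qed.

Lemma is_derive_lincomb {R : realType} (w : nat -> R -> R) (c : nat -> R)
    (N : nat) (t : R) :
  (forall i, (1 <= i)%N -> derivable (w i) t 1) ->
  is_derive t 1 (fun t => \sum_(1 <= i < N.+1) c i * w i t)
    (\sum_(1 <= i < N.+1) c i * (w i)^`()%classic t).
Proof.
move=> dw; elim: N => [|N IH].
  rewrite big_geq// (_ : (fun t => _) = cst 0); first exact: is_derive_cst.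
  by apply/funext => s; rewrite big_geq.
rewrite (_ : (fun t => _) = (fun t => \sum_(1 <= i < N.+1) c i * w i t)
    \+ (fun t => c N.+1 * w N.+1 t)); last first.
  by apply/funext => s /=; rewrite big_nat_recr.
rewrite big_nat_recr//=; apply: is_deriveD.
apply: is_deriveZ; rewrite derive1E; apply: derivableP; exact: dw.
Qed.

Lemma ln_lipschitz {R : realType} (x y : R) : 1 <= x -> 1 <= y ->
  `|ln y - ln x| <= `|y - x|.
Proof.
wlog xy : x y / x <= y.
  move=> W x1 y1; have [|/ltW] := leP x y; first by move=> ?; exact: W.
  by move=> yx; rewrite distrC [leRHS]distrC; exact: W.
move=> x1 y1.
have x0 : 0 < x by lra.
have y0 : 0 < y by lra.
rewrite !ger0_norm ?subr_ge0 ?ler_ln ?posrE//.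
rewrite -ln_div ?posrE//.
have -> : y / x = 1 + (y - x) / x by field; rewrite gt_eqF.
apply: (le_trans (le_ln1Dx _)).
  by rewrite ltr_pdivlMr//; lra.
by rewrite ler_pdivrMr// ler_peMr// subr_ge0.
Qed.

Lemma lebesgue_aeS {R : realType} (P Q : R -> Prop) :
  (forall t, P t -> Q t) ->
  {ae @lebesgue_measure R, forall t, P t} ->
  {ae @lebesgue_measure R, forall t, Q t}.
Proof.
move=> PQ [B [mB B0 PB]]; exists B; split => // t nQ; apply: PB => Pt.
by apply: nQ; exact: PQ.
Qed.

(** Osgood's criterion for the modulus [u ln u]: the derivative of
    [ln (ln (e + y))] is [y' / ((e + y) ln (e + y))].  Absolute continuity
    survives the two logarithms because their arguments stay above 1, where [ln]
    is 1-Lipschitz. *)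
Lemma ae_log_growth_le {R : realType} (y : R -> R) (A T : R) :
  0 <= A -> 0 <= T -> abs_continuous 0 T y ->
  (forall t, 0 <= t -> 0 <= y t) ->
  {ae @lebesgue_measure R, forall t, 0 <= t ->
    derivable y t 1 /\
    y^`()%classic t <= A * ((expR 1 + y t) * ln (expR 1 + y t))} ->
  ln (ln (expR 1 + y T)) <= ln (ln (expR 1 + y 0)) + A * T.
Proof.
move=> A0 T0 acy y0 aey.
have e1 : 1 <= expR 1 :> R by have := expR_ge1Dx (1 : R); lra.
rewrite -lerBlDl -[T in A * T]subr0.
apply: (@abs_continuous_ae_le _ (fun t => ln (ln (expR 1 + y t)))) => //.
  apply: (@abs_continuous_dominated _ _ _ 1 y) => // s t s0 st _.
  have ys := y0 _ s0; have yt := y0 _ (le_trans s0 st).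
  rewrite mul1r; apply: le_trans (ln_lipschitz _ _ _ _) _; rewrite ?ln_e_ge1//.
  apply: le_trans (ln_lipschitz _ _ _ _) _; [lra|lra|].
  by rewrite opprD addrACA subrr add0r.
apply: lebesgue_aeS aey => t H /andP[t0 _]; have [dy yA] := H t0.
have l1 := ln_e_ge1 _ (y0 _ t0).
have ey0 : 0 < expR 1 + y t by have := y0 _ t0; lra.
have ly0 : 0 < ln (expR 1 + y t) by lra.
have dY : is_derive t 1 (fun t => expR 1 + y t) (y^`()%classic t).
  rewrite -[y^`()%classic t]add0r; apply: is_deriveD.
  by rewrite derive1E; exact: derivableP.
have dL : is_derive t 1 (fun t => ln (expR 1 + y t))
    ((expR 1 + y t)^-1 * y^`()%classic t).
  exact: (@is_derive1_comp _ _ (fun t => expR 1 + y t) _ _ _ (is_derive1_ln ey0) dY).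
have dLL : is_derive t 1 (fun t => ln (ln (expR 1 + y t)))
    ((ln (expR 1 + y t))^-1 * ((expR 1 + y t)^-1 * y^`()%classic t)).
  exact: (@is_derive1_comp _ _ (fun t => ln (expR 1 + y t)) _ _ _
    (is_derive1_ln ly0) dL).
split; first exact: ex_derive.
rewrite derive1E derive_val mulrA -invfM mulrC ler_pdivrMr ?mulr_gt0//.
by rewrite [ln _ * _]mulrC.
Qed.

(** * Moments of a solution *)

Lemma trunc_moment_le_moment {R : realType} (p : nat) (w : nat -> R) (N : nat) :
  (forall i, (1 <= i)%N -> 0 <= w i) ->
  ((trunc_moment p w N)%:E <= moment p w)%E.
Proof.
move=> w0; rewrite /trunc_moment -sumEFin; apply: nneseries_lim_ge => i i1 _.
by rewrite lee_fin mulr_ge0 ?exprn_ge0 ?w0.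
Qed.

Lemma moment_le {R : realType} (p : nat) (w : nat -> R) (y : \bar R) :
  (forall i, (1 <= i)%N -> 0 <= w i) ->
  (forall N, ((trunc_moment p w N)%:E <= y)%E) -> (moment p w <= y)%E.
Proof.
move=> w0 wy; apply: lime_le.
  by apply: is_cvg_nneseries => i i1 _; rewrite lee_fin mulr_ge0 ?exprn_ge0 ?w0.
apply: nearW => -[|n]; last by rewrite sumEFin; exact: wy.
rewrite big_geq//; apply: le_trans (wy 0).
by rewrite /trunc_moment big_geq.
Qed.

Lemma moment_finite {R : realType} (p : nat) (w : nat -> R) :
  (forall i, (1 <= i)%N -> 0 <= w i) -> (moment p w < +oo)%E ->
  exists2 m : R, 0 <= m & moment p w = m%:E.
Proof.
move=> w0 fin.
have m0 : (0 <= moment p w)%E.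
  apply: le_trans (trunc_moment_le_moment p w 0 w0).
  by rewrite /trunc_moment big_geq.
case: (moment p w) fin m0 => [m _ m0| |]//; exists m => //.
Qed.

Lemma trunc_moment_ge0 {R : realType} (p : nat) (w : nat -> R) (N : nat) :
  (forall i, (1 <= i)%N -> 0 <= w i) -> 0 <= trunc_moment p w N.
Proof.
move=> w0; rewrite /trunc_moment big_nat_cond sumr_ge0// => i /andP[/andP[i1 _] _].
by rewrite mulr_ge0 ?exprn_ge0 ?w0.
Qed.

Lemma ohs_solution_ae {R : realType} (Lam : nat -> nat -> R) (win : nat -> R)
    (omega : nat -> R -> R) :
  ohs_solution Lam win omega ->
  {ae @lebesgue_measure R, forall t, 0 <= t ->
    (forall i, (1 <= i)%N -> derivable (omega i) t 1) /\
    ohs_state Lam (omega ^~ t) (fun i => (omega i)^`()%classic t)}.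
Proof.
move=> sol; apply: lebesgue_aeS (ohs_eqn sol) => t H t0; split; last split.
- by move=> i i1; have [] := H t0 i i1.
- by move=> i i1; exact: (ohs_ge0 sol).
- by move=> i i1; have [] := H t0 i i1.
Qed.

(** Bounds on the rate of a finite combination of concentrations, obtained from
    the equations at one time, integrate to bounds on its growth. *)
Lemma lincomb_growth_le {R : realType} (Lam : nat -> nat -> R) (win : nat -> R)
    (omega : nat -> R -> R) (c : nat -> R) (N : nat) (K T : R) :
  ohs_solution Lam win omega -> 0 <= K -> 0 <= T ->
  (forall t d, 0 <= t <= T -> ohs_state Lam (omega ^~ t) d ->
     \sum_(1 <= i < N.+1) c i * d i <= K) ->
  \sum_(1 <= i < N.+1) c i * omega i T <=
  \sum_(1 <= i < N.+1) c i * win i + K * T.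
Proof.
move=> sol K0 T0 rate.
have -> : \sum_(1 <= i < N.+1) c i * win i = \sum_(1 <= i < N.+1) c i * omega i 0.
  by apply: eq_big_nat => i /andP[i1 _]; rewrite (ohs_init sol).
move: T0; rewrite le_eqVlt => /predU1P[T0|T0].
  by rewrite -T0 mulr0 addr0.
rewrite -lerBlDl -[T in K * T]subr0.
apply: (@abs_continuous_ae_le _ (fun t => \sum_(1 <= i < N.+1) c i * omega i t)) => //.
- exact: ltW.
- by apply: abs_continuous_lincomb => i i1; exact: (ohs_lac sol).
- apply: lebesgue_aeS (ohs_solution_ae _ _ _ sol) => t H tT.
  have [dw st] := H (proj1 (andP tT)).
  have D := is_derive_lincomb omega c N t dw.
  split; first exact: ex_derive.
  by rewrite derive1E derive_val; exact: rate st.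
Qed.

Lemma trunc_mass_le {R : realType} (Lam : nat -> nat -> R) (win : nat -> R)
    (omega : nat -> R -> R) (N : nat) (t : R) :
  (forall i j, (1 <= i)%N -> (1 <= j)%N -> Lam i j = Lam j i) ->
  (forall i j, (1 <= i)%N -> (1 <= j)%N -> 0 <= Lam i j) ->
  ohs_solution Lam win omega -> 0 <= t ->
  trunc_moment 1 (omega ^~ t) N <= trunc_moment 1 win N.
Proof.
move=> Lsym L0 sol t0.
have := lincomb_growth_le Lam win omega (fun i => i%:R ^+ 1) N 0 t sol (lexx _) t0.
rewrite mul0r addr0; apply => s d _ st.
exact: mass_rate_le0 st.
Qed.

(** By [log_moment_le] with the tangent point at the truncated second moment
    [y], the inequality for [y] closes on itself with constants that do not
    depend on [N], so that [ae_log_growth_le] gives a uniform bound. *)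
Lemma second_moment_bound {R : realType} (Lam : nat -> nat -> R) (win : nat -> R)
    (omega : nat -> R -> R) (C m1 m2 T : R) :
  (forall i j, (1 <= i)%N -> (1 <= j)%N -> Lam i j = Lam j i) ->
  (forall i j, (1 <= i)%N -> (1 <= j)%N -> 0 <= Lam i j) ->
  0 <= C -> log_linear_kernel Lam C ->
  ohs_solution Lam win omega ->
  0 <= m1 -> (forall N, trunc_moment 1 win N <= m1) ->
  0 <= m2 -> (forall N, trunc_moment 2 win N <= m2) ->
  0 <= T -> exists B : R, forall t N, 0 <= t <= T ->
    trunc_moment 2 (omega ^~ t) N <= B.
Proof.
move=> Lsym L0 C0 LC sol m10 M1 m20 M2 T0.
(* The extra 1 absorbs [y / (e + y) <= 1 <= ln (e + y)]. *)
pose A := 6 * C * (m1 + 1).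
have A0 : 0 <= A by rewrite /A !mulr_ge0// addr_ge0.
exists (expR (expR (ln (ln (expR 1 + m2)) + A * T))) => t N /andP[t0 tT].
have w0 s : 0 <= s -> forall i, (1 <= i)%N -> 0 <= omega i s.
  by move=> s0 i i1; exact: (ohs_ge0 sol).
have e0 := expR_gt0 (1 : R).
pose y s := trunc_moment 2 (omega ^~ s) N.
have y0 s : 0 <= s -> 0 <= y s by move=> s0; exact/trunc_moment_ge0/w0.
have m2l := ln_e_ge1 _ m20.
have H : ln (ln (expR 1 + y t)) <= ln (ln (expR 1 + y 0)) + A * t.
  move: (t0); rewrite le_eqVlt => /predU1P[<-|tp]; first by rewrite mulr0 addr0.
  apply: ae_log_growth_le => //.
    by apply: abs_continuous_lincomb => i i1; exact: (ohs_lac sol).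
  apply: lebesgue_aeS (ohs_solution_ae _ _ _ sol) => s Hs s0.
  have [dw st] := Hs s0.
  have D := is_derive_lincomb omega (fun i => i%:R ^+ 2) N s dw.
  split; first exact: ex_derive.
  rewrite derive1E derive_val.
  apply: le_trans (second_moment_rate_le _ _ _ _ N Lsym L0 C0 LC st) _.
  have ys := y0 s s0; have ls := ln_e_ge1 _ ys.
  have Lm : log_moment (omega ^~ s) N <= (m1 + 1) * ln (expR 1 + y s).
    apply: le_trans (log_moment_le _ N _ ys (w0 s s0)) _.
    rewrite mulrDl mul1r lerD//.
      apply: ler_wpM2r; first by lra.
      by apply: le_trans (M1 N); exact: trunc_mass_le sol s0.
    apply: le_trans ls; rewrite ler_pdivrMr ?ltr_pwDl// mul1r.
    by rewrite lerDr ltW.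
  rewrite -/(y s).
  apply: (@le_trans _ _ (6 * C * y s * ((m1 + 1) * ln (expR 1 + y s)))).
    by apply: ler_wpM2l => //; rewrite !mulr_ge0.
  have -> : 6 * C * y s * ((m1 + 1) * ln (expR 1 + y s)) =
    A * (y s * ln (expR 1 + y s)) by rewrite /A; ring.
  apply: ler_wpM2l => //; apply: ler_wpM2r; first by lra.
  by rewrite lerDr ltW.
have y0m2 : y 0 <= m2.
  apply: le_trans (M2 N); rewrite /y /trunc_moment ler_sum_nat// => i /andP[i1 _].
  by rewrite (ohs_init sol).
have yt := y0 t t0; have ytl := ln_e_ge1 _ yt.
have y00 := y0 0 (lexx 0); have y0l := ln_e_ge1 _ y00.
have ey : 0 < expR 1 + y t by rewrite ltr_pwDl.
rewrite -/(y t); apply: (@le_trans _ _ (expR 1 + y t)); first by rewrite lerDr ltW.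
rewrite -[leLHS]lnK ?posrE// ler_expR -[leLHS]lnK ?posrE ?ler_expR; last by lra.
apply: (le_trans H); apply: lerD; last exact: ler_wpM2l.
rewrite ler_ln ?posrE ?ler_ln ?posrE ?lerD2l ?ltr_pwDl//; lra.
Qed.

(** The weight [i (N + 1 - i)] counts [i] once for every truncation between [i]
    and [N], hence at least [N + 1 - p] times when [i <= p]. *)
Lemma cesaro_mass_ge {R : realType} (w : nat -> R) (N p : nat) :
  (forall i, (1 <= i)%N -> 0 <= w i) -> (p <= N)%N ->
  (N.+1%:R - p%:R) * trunc_moment 1 w p <=
  \sum_(1 <= i < N.+1) (i%:R * (N.+1%:R - i%:R)) * w i.
Proof.
move=> w0 pN; rewrite (@big_cat_nat _ _ _ p.+1 1 N.+1)//=.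
rewrite -[leLHS]addr0 lerD//; last first.
  rewrite big_nat_cond sumr_ge0// => i /andP[/andP[pi iN] _].
  by rewrite !mulr_ge0 ?w0// ?subr_ge0 ?ler_nat; lia.
rewrite /trunc_moment mulr_sumr; apply: ler_sum_nat => i /andP[i1 ip].
rewrite expr1 mulrA [_ * i%:R]mulrC; apply: ler_wpM2r; first exact: w0.
by apply: ler_wpM2l => //; rewrite lerD2l lerN2 ler_nat.
Qed.

Lemma cesaro_mass_le {R : realType} (w : nat -> R) (N : nat) :
  (forall i, (1 <= i)%N -> 0 <= w i) ->
  \sum_(1 <= i < N.+1) (i%:R * (N.+1%:R - i%:R)) * w i <=
  N.+1%:R * trunc_moment 1 w N.
Proof.
move=> w0; rewrite /trunc_moment mulr_sumr; apply: ler_sum_nat => i /andP[i1 _].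
rewrite expr1 mulrA [_ * i%:R]mulrC; apply: ler_wpM2r; first exact: w0.
by apply: ler_wpM2l => //; rewrite lerBlDr lerDl.
Qed.

(** The [N] truncated masses lose together at most [K t], with [K] independent
    of [N].  If the final mass were below an initial truncated mass, the
    difference would be counted about [N] times, a contradiction. *)
Lemma trunc_mass_retained {R : realType} (Lam : nat -> nat -> R)
    (win : nat -> R) (omega : nat -> R -> R) (C m B M t : R) (p : nat) :
  (forall i j, (1 <= i)%N -> (1 <= j)%N -> Lam i j = Lam j i) ->
  (forall i j, (1 <= i)%N -> (1 <= j)%N -> 0 <= Lam i j) ->
  (forall i, (1 <= i)%N -> 0 <= win i) ->
  0 <= C -> log_linear_kernel Lam C ->
  ohs_solution Lam win omega -> 0 <= m ->
  (forall N, trunc_moment 1 win N <= m) -> 0 <= t ->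
  (forall s N, 0 <= s <= t -> trunc_moment 2 (omega ^~ s) N <= B) ->
  (forall N, trunc_moment 1 (omega ^~ t) N <= M) ->
  trunc_moment 1 win p <= M.
Proof.
move=> Lsym L0 w0 C0 LC sol m0 Mm t0 MB MM; rewrite leNgt; apply/negP => MP.
have B0 : 0 <= B.
  by have := MB 0 0%N; rewrite lexx t0 /trunc_moment big_geq// => /(_ isT).
have wt0 s : 0 <= s -> forall i, (1 <= i)%N -> 0 <= omega i s.
  by move=> s0 i i1; exact: (ohs_ge0 sol).
pose P := trunc_moment 1 win p; pose K := 8 * C * B * (m + B).
have K0 : 0 <= K by rewrite /K !mulr_ge0// addr_ge0.
have H N : (p <= N)%N -> N.+1%:R * (P - M) <= p%:R * P + K * t.
  move=> pN; have lo := cesaro_mass_ge win N p w0 pN.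
  have hi := cesaro_mass_le _ N (wt0 t t0).
  have hiM : N.+1%:R * trunc_moment 1 (omega ^~ t) N <= N.+1%:R * M.
    exact: ler_wpM2l.
  have neg v : \sum_(1 <= i < N.+1) - (i%:R * (N.+1%:R - i%:R)) * v i =
      - (\sum_(1 <= i < N.+1) (i%:R * (N.+1%:R - i%:R)) * v i) :> R.
    by rewrite -sumrN; apply: eq_bigr => i _; rewrite mulNr.
  have := lincomb_growth_le Lam win omega
    (fun i => - (i%:R * (N.+1%:R - i%:R))) N K t sol K0 t0.
  rewrite !neg => G.
  suff : - \sum_(1 <= i < N.+1) i%:R * (N.+1%:R - i%:R) * omega i t <=
      - \sum_(1 <= i < N.+1) i%:R * (N.+1%:R - i%:R) * win i + K * t.
    by rewrite /P; lra.
  apply: G => s d st state; rewrite neg lerNl.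
  have /andP[s0 _] := st.
  apply: le_trans (cesaro_mass_rate_ge Lam C B _ d N Lsym L0 C0 LC state _); last first.
    by move=> n; exact: MB.
  rewrite lerN2 /K; apply: ler_wpM2l; first by rewrite !mulr_ge0.
  apply: le_trans (log_moment_le _ N 0 (lexx _) (wt0 s s0)) _.
  rewrite addr0 expRK mulr1 lerD//.
    by apply: le_trans (Mm N); exact: trunc_mass_le sol s0.
  apply: le_trans (MB s N st); rewrite ler_pdivrMr ?expR_gt0// ler_peMr//.
    exact/trunc_moment_ge0/wt0.
  by have := expR_ge1Dx (1 : R); lra.
have PM : 0 < P - M by rewrite subr_gt0.
have P0 : 0 <= P by exact: trunc_moment_ge0.
have Q0 : 0 <= (p%:R * P + K * t) / (P - M).
  by rewrite divr_ge0 ?(ltW PM)// addr_ge0// mulr_ge0.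
have := archi_boundP Q0; set b := Num.bound _; rewrite ltr_pdivrMr// => Hb.
have := le_lt_trans (H (p + b)%N (leq_addr _ _)) Hb.
by rewrite ltr_pM2r// ltr_nat; lia.
Qed.

Theorem proposition4p2 (R : realType) (Lam : nat -> nat -> R) (win : nat -> R)
  (Lam_sym : forall i j : nat, (1 <= i)%N -> (1 <= j)%N -> Lam i j = Lam j i)
  (Lam_ge0 : forall i j : nat, (1 <= i)%N -> (1 <= j)%N -> 0 <= Lam i j)
  (win_ge0 : forall i : nat, (1 <= i)%N -> 0 <= win i)
  (Lam_le : exists2 C1 : R, 0 < C1 &
     forall i j : nat, (1 <= i)%N -> (1 <= j)%N ->
       Lam i j <= C1 * (i + j)%:R * ln (expR 1 + (minn i j)%:R))
  (moments_fin : (moment 1 win + moment 2 win < +oo)%E) :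
  forall omega : nat -> R -> R, ohs_solution Lam win omega ->
  forall t : R, 0 <= t -> moment 1 (fun i => omega i t) = moment 1 win.
Proof.
move=> omega sol t t0.
have [C C_gt0 LC] := Lam_le; have C0 := ltW C_gt0.
have [fin1 fin2] : (moment 1 win < +oo)%E /\ (moment 2 win < +oo)%E.
  have ge0 q : (0 <= moment q win)%E.
    apply: le_trans (trunc_moment_le_moment q win 0 win_ge0).
    by rewrite /trunc_moment big_geq.
  by split; apply: le_lt_trans moments_fin; rewrite ?leeDl ?leeDr.
have [m1 m10 E1] := moment_finite 1 win win_ge0 fin1.
have [m2 m20 E2] := moment_finite 2 win win_ge0 fin2.
have M1 N : trunc_moment 1 win N <= m1.
  by rewrite -lee_fin -E1; exact: trunc_moment_le_moment.
have M2 N : trunc_moment 2 win N <= m2.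
  by rewrite -lee_fin -E2; exact: trunc_moment_le_moment.
have wt0 i : (1 <= i)%N -> 0 <= omega i t by move=> i1; exact: (ohs_ge0 sol).
have le1 : (moment 1 (fun i => omega i t) <= moment 1 win)%E.
  apply: moment_le => // N.
  apply: le_trans (trunc_moment_le_moment 1 win N win_ge0).
  by rewrite lee_fin; exact: trunc_mass_le sol t0.
apply/eqP; rewrite eq_le le1 /=; apply: moment_le => // p.
have [M M0 EM] := moment_finite 1 (fun i => omega i t) wt0 (le_lt_trans le1 fin1).
have [B MB] := second_moment_bound _ _ _ _ _ _ _ Lam_sym Lam_ge0 C0 LC sol
  m10 M1 m20 M2 t0.
rewrite EM lee_fin.
apply: (trunc_mass_retained _ _ _ _ _ _ _ _ p Lam_sym Lam_ge0 win_ge0 C0 LC sol m10 M1 t0 MB).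
by move=> N; rewrite -lee_fin -EM; exact: trunc_moment_le_moment.
Qed.
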